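(* Let $A \in \{0,\pm1\}^{n\times n}$ be a symmetric matrix with zero diagonal, and let $G_\sigma$ be the signed graph whose signed adjacency matrix is $A$. Let $k=\rho_{\mathrm{per}}(A)$. Then \[ \rho_{\mathrm{per}}(A)+\eta_{\mathrm{per}}(A)=n \quad\text{if and only if}\quad E_k\neq O_k , \] where \[ E_i=(-1)^i\sum_{\substack{U_i\\ c^-(U_i)\text{ even}}}2^{c(U_i)},\qquad O_i=(-1)^i\sum_{\substack{U_i\\ c^-(U_i)\text{ odd}}}2^{c(U_i)}, \] the sums ranging over all Sachs subgraphs $U_i$ of $G_\sigma$ on exactly $i$ vertices, $c(U_i)$ being the number of cycles in $U_i$ and $c^-(U_i)$ the number of negative cycles in $U_i$.
   Context: For an $m\times m$ matrix $B$, $\mathrm{per}(B)=\sum_{\sigma\in S_m}\prod_i b_{i,\sigma(i)}$. The permanental rank $\rho_{\mathrm{per}}(A)$ is the largest $k$ such that some $k\times k$ submatrix $A[I,J]$ (rows $I$, columns $J$, $|I|=|J|=k$) has nonzero permanent; the permanental nullity $\eta_{\mathrm{per}}(A)$ is the multiplicity of $0$ as a root of $\pi(A,x)=\mathrm{per}(A-xI)$. A signed graph $G_\sigma$ is a simple undirected graph with each edge $\{u,v\}$ given a sign $\sigma(u,v)\in\{+1,-1\}$; its signed adjacency matrix has $(u,v)$ entry $\sigma(u,v)$ if $\{u,v\}$ is an edge and $0$ otherwise. A cycle is negative if it contains an odd number of negative edges, positive otherwise. A Sachs subgraph is a subgraph each of whose connected components is either a single edge or a cycle; ''on $i$ vertices''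 means its vertex set has size $i$. *)

(* Defs.v *)
From mathcomp Require Import all_boot all_order all_algebra all_fingroup.

Set Implicit Arguments.
Unset Strict Implicit.
Unset Printing Implicit Defensive.

Import GRing.Theory Num.Theory.
Local Open Scope ring_scope.

Definition per (R : comNzRingType) (m : nat) (B : 'M[R]_m) : R :=
  \sum_(s : 'S_m) \prod_i B i (s i).

Definition increasing (k n : nat) (f : {ffun 'I_k -> 'I_n}) : bool :=
  [forall i : 'I_k, forall j : 'I_k, (i < j)%N ==> (f i < f j)%N].

(* A k x k submatrix A[I, J] is given by the increasing enumerations f and g
   of I and J. The index k = 0 always qualifies (empty permanent = 1). *)
Definition per_rank (R : comNzRingType) (n : nat) (A : 'M[R]_n) : nat :=
  \max_(k < n.+1 | [exists f : {ffun 'I_k -> 'I_n},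
                    exists g : {ffun 'I_k -> 'I_n},
      [&& increasing f, increasing g & per (mxsub f g A) != 0]]) k.

Definition per_poly (R : comNzRingType) (n : nat) (A : 'M[R]_n) : {poly R} :=
  per (map_mx polyC A - 'X%:M).

Definition per_nullity (F : fieldType) (n : nat) (A : 'M[F]_n) : nat :=
  mup 0 (per_poly A).

(* Edges are two-element vertex sets; the values of sg_sign outside sg_edges
   are irrelevant. *)
Record signed_graph (T : finType) := SignedGraph {
  sg_edges : {set {set T}};
  sg_sign : {set T} -> int;
  sg_edges_card : forall e, e \in sg_edges -> #|e| = 2%N;
  sg_signP : forall e, e \in sg_edges -> sg_sign e = 1 \/ sg_sign e = -1 }.

Definition signed_adj (R : pzRingType) (n : nat) (G : signed_graph 'I_n) :
    'M[R]_n :=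
  \matrix_(u, v)
    if [set u; v] \in sg_edges G then (sg_sign G [set u; v])%:~R else 0.
Arguments signed_adj R {n} G.

Section Subgraphs.

Variables (T : finType) (G : signed_graph T).

(* A candidate subgraph is a pair (vertex set, edge set). *)
Implicit Types (U : {set T} * {set {set T}}) (C : {set T}).

Definition is_subgraph U : bool :=
  (U.2 \subset sg_edges G) && [forall e in U.2, e \subset U.1].

Definition sub_adj U : rel T := [rel u v | [set u; v] \in U.2].

Definition components U : {set {set T}} :=
  [set [set v | connect (sub_adj U) u v] | u in U.1].

Definition comp_edges U C : {set {set T}} := [set e in U.2 | e \subset C].

Definition is_single_edge U C : bool :=
  (#|C| == 2)%N && (comp_edges U C == [set C]).

(* The vertices of C can be listed as c = (c_1, ..., c_m), m >= 3, so that the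
   edges are exactly {c_1, c_2}, ..., {c_(m-1), c_m}, {c_m, c_1}. *)
Definition is_cycle U C : bool :=
  (2 < #|C|)%N &&
  [exists c : #|C|.-tuple T,
    [&& uniq c, [set x in c] == C &
        comp_edges U C == [set [set x; next c x] | x in C]]].

Definition is_sachs U : bool :=
  is_subgraph U &&
  [forall C in components U, is_single_edge U C || is_cycle U C].

Definition cycles U : {set {set T}} := [set C in components U | is_cycle U C].

Definition is_negative U C : bool :=
  odd #|[set e in comp_edges U C | sg_sign G e == -1]|.

Definition c_all U : nat := #|cycles U|.

Definition c_neg U : nat := #|[set C in cycles U | is_negative U C]|.

Definition E_ (i : nat) : int :=
  (-1) ^+ i *
  \sum_(U | [&& is_sachs U, #|U.1| == i & ~~ odd (c_neg U)]) 2 ^+ c_all U.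

Definition O_ (i : nat) : int :=
  (-1) ^+ i *
  \sum_(U | [&& is_sachs U, #|U.1| == i & odd (c_neg U)]) 2 ^+ c_all U.

End Subgraphs.

(* Every symmetric {0, 1, -1}-matrix with zero diagonal is the signed adjacency
   matrix of some signed graph. *)
Lemma signed_adj_exists (R : nzRingType) (n : nat) (A : 'M[R]_n) :
  (forall i j, A i j \in [:: 0; 1; -1]) -> A^T = A -> (forall i, A i i = 0) ->
  exists G : signed_graph 'I_n, signed_adj R G = A.
Proof.
move=> A01 Asym Adiag.
have sA u v : A v u = A u v by rewrite -[in LHS]Asym mxE.
have eqA (a b u v : 'I_n) : [set a; b] = [set u; v] -> A a b = A u v.
  move=> eab.
  have /set2P ha : a \in [set u; v] by rewrite -eab set21.
  have /set2P hb : b \in [set u; v] by rewrite -eab set22.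
  have /set2P hu : u \in [set a; b] by rewrite eab set21.
  have /set2P hv : v \in [set a; b] by rewrite eab set22.
  by case: ha => ?; case: hb => ?; case: hu => ?; case: hv => ?; subst.
pose E := [set [set p.1; p.2] | p : 'I_n * 'I_n & A p.1 p.2 != 0].
pose s (e : {set 'I_n}) : int :=
  if [exists u : 'I_n, exists v : 'I_n, (e == [set u; v]) && (A u v == -1)]
  then -1 else 1.
have EP u v : ([set u; v] \in E) = (A u v != 0).
  apply/imsetP/idP => [[[a b]] | nz]; last by exists (u, v); rewrite ?inE.
  by rewrite inE /= => nz eqe; rewrite (eqA _ _ _ _ eqe).
have Ecard e : e \in E -> #|e| = 2%N.
  case/imsetP=> -[a b]; rewrite inE /= => nz ->; rewrite cards2.
  by case: (eqVneq a b) nz => // ->; rewrite Adiag eqxx.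
have sP e : e \in E -> s e = 1 \/ s e = -1.
  by move=> _; rewrite /s; case: ifP; [right | left].
exists (SignedGraph Ecard sP); apply/matrixP=> u v; rewrite mxE /= EP.
case: eqVneq => [-> // | nz] /=; rewrite /s.
case: ifPn => [/existsP[a /existsP[b /andP[/eqP /eqA -> /eqP ->]]] | ].
  by rewrite mulrNz.
move=> /existsPn /(_ u) /existsPn /(_ v); rewrite eqxx /= => nm1.
by have := A01 u v; rewrite !inE (negPf nz) (negPf nm1) orbF /= => /eqP.
Qed.

(* Main.v *)
Require Import Defs.
From mathcomp Require Import all_boot all_order all_algebra all_fingroup.

(* Since A has zero diagonal, per (A - x I) is the sum over permutations s of
   (-x)^(n - |supp s|) times the product of the A x (s x) over the support of s.
   For fixed |supp s| = i these products sum to the sum of the principal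
   i x i permanents, which vanishes for i > k; hence the nullity is at least
   n - k, with equality exactly when the sum for i = k is nonzero.

   A permutation s with nonzero product traces out a Sachs subgraph: its vertices
   are supp s, its edges the {x, s x}. Conversely every Sachs subgraph U arises
   from exactly 2^c(U) permutations, since each of its cycles can be traversed in
   two directions, and all of them have product (-1)^(c^-(U)): a transposition
   contributes the square of a sign and a longer orbit the sign of its cycle.
   So the sum for i = k is (-1)^k (E_k - O_k). *)

Set Implicit Arguments.
Unset Strict Implicit.
Unset Printing Implicit Defensive.

Import GRing.Theory Num.Theory.
Local Open Scope ring_scope.

(** * The graph of a permutation *)

Section PermGraph.

Variable T : finType.
Implicit Types (s t : {perm T}) (x y : T) (C : {set T}).

Definition psupp t : {set T} := [set x | t x != x].

(** A transposition contributes a single edge, because [[set x; t x]] and [[set t x; x]]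
    coincide. *)
Definition pgraph t : {set T} * {set {set T}} :=
  (psupp t, [set [set x; t x] | x in psupp t]).

Lemma eq_set2 x y z w :
  [set x; y] = [set z; w] -> (x = z /\ y = w) \/ (x = w /\ y = z).
Proof.
move=> e.
have /set2P ha : x \in [set z; w] by rewrite -e set21.
have /set2P hb : y \in [set z; w] by rewrite -e set22.
have /set2P hu : z \in [set x; y] by rewrite e set21.
have /set2P hv : w \in [set x; y] by rewrite e set22.
by case: ha => ?; case: hb => ?; case: hu => ?; case: hv => ?; subst; tauto.
Qed.

Lemma mem_pgraph t x y :
  ([set x; y] \in (pgraph t).2) = (x != y) && ((t x == y) || (t y == x)).
Proof.
apply/imsetP/andP => [[z] | [nxy /orP[/eqP e|/eqP e]]].
- rewrite inE => nz /eq_set2 [[-> ->]|[-> ->]].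
    by rewrite eq_sym nz eqxx.
  by rewrite nz eqxx orbT.
- by exists x; rewrite ?inE ?e // eq_sym.
- by exists y; rewrite ?inE ?e // setUC.
Qed.

Lemma mem_pgraph_succ t x : t x != x -> [set x; t x] \in (pgraph t).2.
Proof. by move=> nx; rewrite mem_pgraph eq_sym nx eqxx. Qed.

Lemma mem_psupp_pgraph t x : (t x != x) = [exists y, [set x; y] \in (pgraph t).2].
Proof.
apply/idP/existsP => [nx|[y]]; first by exists (t x); apply: mem_pgraph_succ.
rewrite mem_pgraph => /andP[nxy /orP[/eqP->|/eqP tyx]]; first by rewrite eq_sym.
by rewrite -{2}tyx (inj_eq perm_inj).
Qed.

Lemma psupp_eq s t : (pgraph s).2 = (pgraph t).2 -> psupp s = psupp t.
Proof. by move=> e; apply/setP=> x; rewrite !inE !mem_psupp_pgraph e. Qed.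

Lemma pgraph_eq s t : (pgraph s).2 = (pgraph t).2 -> pgraph s = pgraph t.
Proof.
by move=> e; apply: injective_projections => //=; apply: psupp_eq.
Qed.

Lemma pgraphV t : pgraph t^-1 = pgraph t.
Proof.
apply/pgraph_eq/setP=> e; apply/imsetP/imsetP => -[x]; rewrite inE => nx ->.
  by exists (t^-1%g x); rewrite ?inE permKV ?(eq_sym x) // setUC.
by exists (t x); rewrite ?inE permK ?(eq_sym x) // setUC.
Qed.

(** The neighbours of a moved point [x] in the graph of [t] are exactly [t x] and [t^-1 x], and
    [s x] is such a neighbour. *)
Lemma pgraph_step s t x : (pgraph s).2 = (pgraph t).2 ->
  s x = t x \/ s x = t^-1%g x.
Proof.
move=> e; case: (eqVneq (s x) x) => [sx|nsx].
  left; have : (s x != x) = (t x != x) by rewrite !mem_psupp_pgraph e.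
  by rewrite sx eqxx => /esym/negbFE/eqP.
have := mem_pgraph_succ nsx; rewrite e mem_pgraph => /andP[_ /orP[/eqP->|/eqP h]].
  by left.
by right; rewrite -[in RHS]h permK.
Qed.

(** Direction propagates along the orbit: having gone from [x] to [t x], [s] can turn back only if
    [t] does too. *)
Lemma pgraph_agree_succ s t x : (pgraph s).2 = (pgraph t).2 ->
  s x = t x -> s (t x) = t (t x).
Proof.
move=> e exx; case: (pgraph_step (t x) e) => //; rewrite permK => stx.
rewrite stx; case: (eqVneq x (t (t x))) => // nx; exfalso.
have ntx : t x != x by apply: contraNneq nx => h; rewrite !h.
(* s swaps x and t x, so the edge {t^-1 x, x} of t is not an edge of s. *)
have /mem_pgraph_succ : t (t^-1%g x) != t^-1%g x.
  by rewrite permKV; apply: contraNneq ntx => {1}->; rewrite permKV.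
rewrite permKV -e mem_pgraph => /andP[_ /orP[/eqP h|/eqP h]].
  have /perm_inj h2 : s (t^-1%g x) = s (t x) by rewrite h stx.
  by rewrite -h2 permKV eqxx in nx.
by rewrite -exx h permKV eqxx in nx.
Qed.

Lemma pgraph_agree_porbit s t x y : (pgraph s).2 = (pgraph t).2 ->
  s x = t x -> y \in porbit t x -> s y = t y.
Proof.
move=> e sx /porbitP[i ->]; elim: i => [|i IH]; first by rewrite perm1.
by rewrite expgSr permM; apply: pgraph_agree_succ.
Qed.

(** The orbits with two distinct directions: on an orbit of size at most 2, [t] and [t^-1]
    coincide. *)
Definition long_orbits t : {set {set T}} := [set C in porbits t | 2 < #|C|]%N.

Definition flip_fun t (D : {set {set T}}) x :=
  if porbit t x \in D then t^-1%g x else t x.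

Lemma porbit_succ t x : porbit t (t x) = porbit t x.
Proof. by apply/eqP; rewrite eq_sym eq_porbit_mem porbit_sym (mem_porbit t 1). Qed.

Lemma porbit_pred t x : porbit t (t^-1%g x) = porbit t x.
Proof. by rewrite -porbit_succ permKV. Qed.

Lemma flip_fun_inj t D : injective (flip_fun t D).
Proof.
move=> x y exy.
have p z : porbit t (flip_fun t D z) = porbit t z.
  by rewrite /flip_fun; case: ifP; rewrite ?porbit_succ ?porbit_pred.
have oxy : porbit t x = porbit t y by rewrite -p exy p.
by move: exy; rewrite /flip_fun oxy; case: ifP => _; apply: perm_inj.
Qed.

Definition flip t D : {perm T} := perm (@flip_fun_inj t D).

Lemma flipE t D x : flip t D x = if porbit t x \in D then t^-1%g x else t x.
Proof. by rewrite permE. Qed.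

Lemma pgraph_flip t D : pgraph (flip t D) = pgraph t.
Proof.
apply/pgraph_eq/setP=> e; apply/imsetP/imsetP => -[x]; rewrite inE.
  rewrite flipE; case: ifP => _ nx ->; last by exists x; rewrite ?inE.
  by exists (t^-1%g x); rewrite ?inE permKV ?(eq_sym x) // setUC.
case: (boolP (porbit t x \in D)) => hD nx ->; last first.
  by exists x; rewrite ?inE flipE (negPf hD).
by exists (t x); rewrite ?inE flipE porbit_succ hD permK ?(eq_sym x) // setUC.
Qed.

Lemma porbit_eq2 t x : t (t x) = x -> porbit t x = [set x; t x].
Proof.
move=> h; apply/setP=> y; rewrite !inE; apply/porbitP/orP => [[i ->]|].
  elim: i => [|i]; first by rewrite perm1 eqxx; left.
  by rewrite expgSr permM => -[/eqP->|/eqP->]; rewrite ?h eqxx; [right|left].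
by case=> /eqP->; [exists 0%N; rewrite perm1 | exists 1%N].
Qed.

Lemma mem_long_orbits t x : (porbit t x \in long_orbits t) = (t (t x) != x).
Proof.
rewrite inE imset_f //=; case: eqP => [/porbit_eq2->|h].
  by rewrite cards2; case: eqP.
have nx : x != t x by apply/eqP=> e; apply: h; rewrite -!e.
have ntx : t x != t (t x) by rewrite (inj_eq perm_inj).
have ntxx : x != t (t x) by apply/eqP=> e; apply: h.
rewrite -(_ : #|[set x; t x; t (t x)]| = 3)%N; last first.
  by rewrite -setUA cardsU1 cards2 !inE (negPf nx) (negPf ntxx) ntx.
apply/subset_leq_card/subsetP=> y; rewrite !inE -orbA => /or3P[] /eqP->.
- by rewrite porbit_id.
- exact: (mem_porbit t 1).
- by have := mem_porbit t 2 x; rewrite expgS expg1 permM.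
Qed.

Lemma pgraph_fiber t :
  [set s | pgraph s == pgraph t] = [set flip t D | D in powerset (long_orbits t)].
Proof.
apply/setP=> s; rewrite inE; apply/eqP/imsetP => [es|[D _ ->]]; last exact: pgraph_flip.
have e2 : (pgraph s).2 = (pgraph t).2 by rewrite es.
(* Reverse the orbits on which [s] and [t] disagree somewhere. None is short, because there
   [pgraph_step] leaves only [s x = t x]. *)
exists [set porbit t x | x in [set x | s x != t x]].
  rewrite powersetE; apply/subsetP=> C /imsetP[x]; rewrite inE => nx ->.
  rewrite mem_long_orbits; apply: contraNneq nx => h; apply/eqP.
  by case: (pgraph_step x e2) => // ->; apply: (@perm_inj _ t); rewrite permKV h.
apply/permP=> x; rewrite flipE; case: ifP => [/imsetP[y]|/negbT hx].
  rewrite inE => ny oxy; case: (pgraph_step y e2) => hy; first by rewrite hy eqxx in ny.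
  (* As [s] equals [t^-1] at [y], it does so on the whole orbit: [t^-1] has the same graph and
     orbits as [t]. *)
  apply: (@pgraph_agree_porbit _ _ y) => //; first by rewrite pgraphV.
  by rewrite porbitV -oxy porbit_id.
by apply/eqP; apply: contraNT hx => nx; apply/imsetP; exists x; rewrite ?inE.
Qed.

(** Distinct sets of reversed long orbits give distinct permutations, since [t^-1] and [t] differ at
    every point of a long orbit. *)
Lemma card_pgraph_fiber t :
  #|[set s | pgraph s == pgraph t]| = (2 ^ #|long_orbits t|)%N.
Proof.
rewrite pgraph_fiber card_in_imset ?card_powerset // => D1 D2.
rewrite !powersetE => /subsetP s1 /subsetP s2 e12.
have sD (D D' : {set {set T}}) : {subset D <= long_orbits t} -> flip t D = flip t D' -> D \subset D'.
  move=> sD e; apply/subsetP=> C CD; have := sD _ CD; rewrite inE => /andP[/imsetP[x _ Cx] _].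
  have := sD _ CD; rewrite Cx mem_long_orbits => h; move: CD; rewrite Cx => CD.
  move/permP/(_ x): e; rewrite !flipE CD; case: ifP => // _ e.
  by rewrite -e permKV eqxx in h.
by apply/eqP; rewrite eqEsubset !sD.
Qed.

End PermGraph.

(** * Sachs subgraphs as graphs of permutations *)

Section PermSachs.

Variable T : finType.
Implicit Types (s t : {perm T}) (x y : T) (C : {set T}).

Lemma sub_adj_pgraph t x y :
  sub_adj (pgraph t) x y = (x != y) && ((t x == y) || (t y == x)).
Proof. exact: mem_pgraph. Qed.

Lemma connect_pgraph t x y : connect (sub_adj (pgraph t)) x y = (y \in porbit t x).
Proof.
apply/idP/idP => [cxy|/porbitP[i ->]].
  have cl : closed (sub_adj (pgraph t)) (mem (porbit t x)).
    move=> u v; rewrite sub_adj_pgraph => /andP[_ /orP[]/eqP<-];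
      by rewrite !(porbit_sym _ _ x) porbit_succ.
  by rewrite -(closed_connect cl cxy) porbit_id.
elim: i => [|i IH]; first by rewrite perm1.
rewrite expgSr permM; apply: connect_trans IH _.
set z := (t ^+ i)%g x; case: (eqVneq (t z) z) => [-> //|nz].
exact/connect1/mem_pgraph_succ.
Qed.

Lemma components_pgraph t :
  components (pgraph t) = [set porbit t x | x in psupp t].
Proof.
apply: eq_imset => x; apply/setP=> y.
by rewrite inE connect_pgraph.
Qed.

Lemma mem_psupp_porbit t x y : y \in porbit t x -> (y \in psupp t) = (x \in psupp t).
Proof.
case/porbitP=> i ->; elim: i => [|i IH]; first by rewrite perm1.
by rewrite -IH expgSr permM !inE (inj_eq perm_inj).
Qed.

Lemma comp_edges_pgraph t x : x \in psupp t ->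
  comp_edges (pgraph t) (porbit t x) = [set [set y; t y] | y in porbit t x].
Proof.
move=> xs; apply/setP=> e; rewrite inE; apply/andP/imsetP => [[]|[y yx ->]].
  case/imsetP=> y ys -> /subsetP h; exists y => //; apply: h; exact: set21.
split; first by apply: imset_f; rewrite (mem_psupp_porbit yx).
apply/subsetP=> z /set2P[->|->] //.
by rewrite porbit_sym porbit_succ -porbit_sym.
Qed.

(** Makes the trajectory of [x] the cyclic listing that [is_cycle] asks for; it closes up because
    iterating [t] as often as the orbit size returns to [x]. *)
Lemma next_traject_porbit t x y : y \in porbit t x ->
  next (traject t x #|porbit t x|) y = t y.
Proof.
move=> yx; apply/esym/eqP; apply: (@next_cycle _ (frel t)); last by rewrite -porbit_traject.
case e: #|porbit t x| => [|m]; first by have := card_porbit_neq0 t x; rewrite e.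
rewrite /= -[X in rcons _ X](_ : iter m.+1 t x = x); last by rewrite -e iter_porbit.
by rewrite iterSr -trajectSr fpath_traject.
Qed.

Lemma is_cycle_pgraph t x : x \in psupp t ->
  is_cycle (pgraph t) (porbit t x) = (2 < #|porbit t x|)%N.
Proof.
move=> xs; rewrite /is_cycle; case: leqP => //= _.
apply/existsP; exists (Tuple (introT eqP (size_traject t x #|porbit t x|))).
rewrite /= uniq_traject_porbit /=; apply/andP; split.
  by apply/eqP/setP=> y; rewrite inE porbit_traject.
rewrite comp_edges_pgraph //; apply/eqP/eq_in_imset => y yx.
by rewrite next_traject_porbit.
Qed.

Lemma card_porbit_gt1 t x : x \in psupp t -> (1 < #|porbit t x|)%N.
Proof.
rewrite inE => nx; apply/card_gt1P; exists x, (t x); split; rewrite 1?eq_sym //.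
  exact: porbit_id.
exact: (mem_porbit t 1).
Qed.

Lemma is_single_edge_pgraph t x : x \in psupp t ->
  is_single_edge (pgraph t) (porbit t x) = (#|porbit t x| == 2)%N.
Proof.
move=> xs; rewrite /is_single_edge; case: eqP => //= c2.
have tt : t (t x) = x.
  apply/eqP; have := mem_long_orbits t x; rewrite inE c2 ltnn andbF.
  by move/esym/negbFE.
rewrite comp_edges_pgraph //; apply/eqP/setP=> e; rewrite !inE (porbit_eq2 tt).
apply/imsetP/eqP => [[y /set2P[]-> ->] //|->]; first by rewrite tt setUC.
by exists x; rewrite ?set21.
Qed.

Lemma cycles_pgraph t : cycles (pgraph t) = long_orbits t.
Proof.
apply/setP=> C; rewrite !inE components_pgraph; apply/andP/andP.
  case=> /imsetP[x xs ->]; rewrite is_cycle_pgraph // => h; split=> //.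
  exact: imset_f.
case=> /imsetP[x _ ->] h.
have xs : x \in psupp t.
  have := mem_long_orbits t x; rewrite !inE h imset_f //= => /esym.
  by apply: contraNneq => e; rewrite !e.
by split; [apply: imset_f | rewrite is_cycle_pgraph].
Qed.

Variable G : signed_graph T.

(** Orbits inside the support have size at least 2, so each is a single edge or a cycle, and only
    membership of the edges in [G] remains to be required. *)
Lemma is_sachs_pgraph t :
  is_sachs G (pgraph t) = ((pgraph t).2 \subset sg_edges G).
Proof.
rewrite /is_sachs /is_subgraph; case: (boolP (_ \subset _)) => //= _.
apply/andP; split.
  apply/forall_inP => _ /imsetP[x xs ->]; apply/subsetP=> y /set2P[]-> //.
  by move: xs; rewrite !inE (inj_eq perm_inj).
rewrite components_pgraph; apply/forall_inP => _ /imsetP[x xs ->].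
rewrite is_cycle_pgraph // is_single_edge_pgraph //.
by rewrite eq_sym -leq_eqVlt card_porbit_gt1.
Qed.

(* A single edge is listed as the "cycle" (u, v), so both kinds of component are
   traversed by [next]. *)
Lemma component_listing U C : is_sachs G U -> C \in components U ->
  exists c : seq T, [/\ uniq c, [set x in c] = C, (1 < size c)%N &
    comp_edges U C = [set [set x; next c x] | x in C]].
Proof.
move=> /andP[_ /forall_inP h] /h /orP[/andP[c2 /eqP ce]|].
  have [x [y [nxy Cxy]]] : exists x y, x != y /\ C = [set x; y].
    by have /cards2P[x [y]] := c2; exists x, y.
  exists [:: x; y]; split => //=.
  - by rewrite inE nxy.
  - by rewrite Cxy; apply/setP=> z; rewrite !inE.
  - rewrite ce Cxy; apply/setP=> e; rewrite !inE; apply/eqP/imsetP => [->|[z]].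
      by exists x; rewrite ?set21 //= eqxx.
    case/set2P=> -> -> /=; first by rewrite eqxx.
    by rewrite eq_sym (negPf nxy) eqxx setUC.
case/andP=> cC /existsP[c /and3P[uc /eqP ec /eqP ce]].
by exists c; split => //; rewrite size_tuple ltnW.
Qed.

Lemma next_neq (c : seq T) x : uniq c -> (1 < size c)%N -> x \in c -> next c x != x.
Proof.
(* Rotation leaves [next] unchanged, so [x] may be put at the head, where its successor is the
   second entry. *)
move=> uc sc xc; case: (rot_to xc) => i c' e.
rewrite -(next_rot i uc) e; have := uc; rewrite -(rot_uniq i) e.
move: sc; rewrite -(size_rot i) e; case: c' e => //= y c' _ _.
by rewrite eqxx inE negb_or eq_sym => /andP[/andP[]].
Qed.

(** The permutation sends each vertex to its successor in a listing of its component and fixes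
    everything outside [U.1]. *)
Lemma sachs_is_pgraph U : is_sachs G U -> exists t, pgraph t = U.
Proof.
move=> sU; pose comp x := [set v | connect (sub_adj U) x v].
have compC x : x \in U.1 -> comp x \in components U by move=> xU; apply: imset_f.
(* One listing is fixed per component, so that all its vertices use the same cyclic order; the empty
   list is a default outside [components U]. *)
have /fin_all_exists[c cP] : forall C : {set T}, exists c : seq T, C \in components U ->
    [/\ uniq c, [set x in c] = C, (1 < size c)%N &
    comp_edges U C = [set [set x; next c x] | x in C]].
  move=> C; case: (boolP (C \in components U)) => hC; last by exists [::].
  by have [c hc] := component_listing sU hC; exists c.
have sym : connect_sym (sub_adj U).
  by apply: sym_connect_sym => x y; rewrite /sub_adj /= setUC.
have compE x y : y \in comp x -> comp y = comp x.
  rewrite inE => cxy; apply/setP=> z; rewrite !inE.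
  by rewrite (same_connect sym cxy).
have idc x : x \in comp x by rewrite inE.
have edgeU e : e \in U.2 -> e \subset U.1.
  by case/andP: sU => /andP[_ /forall_inP h] _; apply: h.
have edge2 e : e \in U.2 -> #|e| = 2%N.
  case/andP: sU => /andP[/subsetP sub _] _ /sub; exact: sg_edges_card.
have memc x : x \in U.1 -> x \in c (comp x).
  by move=> xU; have [_ ec _ _] := cP _ (compC x xU); have := idc x; rewrite -{1}ec inE.
have nextc x : x \in U.1 -> next (c (comp x)) x \in comp x.
  move=> xU; have [_ ec _ _] := cP _ (compC x xU).
  have : next (c (comp x)) x \in [set y in c (comp x)] by rewrite inE mem_next memc.
  by rewrite ec.
have nextU x : x \in U.1 -> [set x; next (c (comp x)) x] \in U.2.
  move=> xU; have [_ _ _ ce] := cP _ (compC x xU).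
  have : [set x; next (c (comp x)) x] \in comp_edges U (comp x).
    by rewrite ce; apply: imset_f.
  by rewrite inE => /andP[].
pose f x := if x \in U.1 then next (c (comp x)) x else x.
have fU x : (f x \in U.1) = (x \in U.1).
  rewrite /f; case: ifP => // xU; apply: (subsetP (edgeU _ (nextU _ xU))).
  exact: set22.
(* Successors stay in the component, so equal images force equal components, hence the same listing,
   on which [prev] inverts [next]. *)
have f_inj : injective f.
  move=> x y e; have := fU x; rewrite e fU => exy.
  move: e; rewrite /f exy; case: ifP => // xU e; have yU : y \in U.1 by rewrite exy.
  have exyc : comp x = comp y by rewrite -(compE _ _ (nextc _ xU)) e (compE _ _ (nextc _ yU)).
  have [uc _ _ _] := cP _ (compC x xU).
  by move: e; rewrite -exyc => /(can_inj (prev_next uc)).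
exists (perm f_inj).
have fst : psupp (perm f_inj) = U.1.
  apply/setP=> x; rewrite inE permE /f; case: ifP => [xU|]; last by rewrite eqxx.
  by have [uc _ sc _] := cP _ (compC x xU); apply: next_neq => //; apply: memc.
apply: injective_projections => //=; rewrite fst.
apply/setP=> e; apply/imsetP/idP => [[x xU ->]|eU].
  by rewrite permE /f xU nextU.
(* The endpoints of an edge are adjacent, so the edge lies within the component of [x], whose edges
   are exactly the successor pairs. *)
have /eqP/cards2P[x [y [nxy exy]]] := edge2 e eU.
have xU : x \in U.1 by apply: (subsetP (edgeU e eU)); rewrite exy set21.
have [_ _ _ ce] := cP _ (compC x xU).
have : e \in comp_edges U (comp x).
  rewrite inE eU exy; apply/subsetP=> z /set2P[]-> //.
  by rewrite inE connect1 // /sub_adj /= -exy.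
rewrite ce => /imsetP[z zx ez]; have zU : z \in U.1.
  by apply: (subsetP (edgeU e eU)); rewrite ez set21.
by exists z => //; rewrite permE /f zU (compE _ _ zx).
Qed.

End PermSachs.

(** * Signed count of Sachs subgraphs *)

Section SachsExpansion.

Variables (T : finType) (G : signed_graph T).
Implicit Types (s t : {perm T}) (x y : T) (C : {set T}).

Lemma sg_signE e : e \in sg_edges G -> sg_sign G e = (-1) ^+ (sg_sign G e == -1).
Proof. by case/sg_signP=> ->. Qed.

Lemma prod_sign_porbit t x : (pgraph t).2 \subset sg_edges G -> x \in psupp t ->
  \prod_(y in porbit t x) sg_sign G [set y; t y] =
  (-1) ^+ (is_cycle (pgraph t) (porbit t x) && is_negative G (pgraph t) (porbit t x)).
Proof.
move=> /subsetP tG xs; rewrite is_cycle_pgraph //.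
have edge y : y \in porbit t x -> [set y; t y] \in sg_edges G.
  by move=> yx; apply/tG/imset_f; rewrite (mem_psupp_porbit yx).
have longE y : y \in porbit t x -> (2 < #|porbit t x|)%N = (t (t y) != y).
  rewrite porbit_sym => yx; rewrite -mem_long_orbits inE imset_f //=.
  by move: yx; rewrite porbit_sym -eq_porbit_mem => /eqP->.
case: (boolP (2 < #|porbit t x|)%N) => [l|nl] /=.
  (* On a long orbit distinct vertices give distinct edges, as a shared edge would force
     [t (t z) = z]; so the product runs over the edges of the cycle. *)
  rewrite -(big_imset (sg_sign G)) /=; last first.
    move=> y z yx zx /eq_set2[[] //|[e1 e2]].
    by move: l; rewrite (longE z zx) -e1 e2 eqxx.
  rewrite -comp_edges_pgraph // (eq_bigr (fun e => (-1) ^+ (sg_sign G e == -1))); last first.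
    by move=> e; rewrite inE => /andP[/tG /sg_signE].
  rewrite -(big_morph _ (exprD (-1)) (expr0 _)) /is_negative -signr_odd.
  congr (_ ^+ nat_of_bool (odd _)).
  rewrite -sum1_card big_mkcond [RHS]big_mkcond; apply: eq_bigr => e _.
  by rewrite !inE; case: (_ \in _); case: (_ \subset _) => //=; case: eqP.
have tt : t (t x) = x by apply/eqP; have := longE x (porbit_id _ _); rewrite (negPf nl) => /esym/negbFE.
rewrite (porbit_eq2 tt) big_setU1 ?inE 1?eq_sym ?big_set1 ?tt /=; last by move: xs; rewrite inE.
rewrite [X in _ * sg_sign _ X]setUC.
by case: (sg_signP (edge x (porbit_id _ _))) => ->.
Qed.

Lemma prod_sign_perm t : (pgraph t).2 \subset sg_edges G ->
  \prod_(x in psupp t) sg_sign G [set x; t x] = (-1) ^+ c_neg G (pgraph t).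
Proof.
move=> tG; rewrite (partition_big (porbit t) (mem (components (pgraph t)))) /=; last first.
  by move=> x xs; rewrite components_pgraph imset_f.
(* The conjunct [is_cycle] matters: a component that is one negative edge also satisfies
   [is_negative], yet its sign is squared. *)
pose neg C := is_cycle (pgraph t) C && is_negative G (pgraph t) C.
rewrite (eq_bigr (fun C => (-1) ^+ neg C)); last first.
  move=> C; rewrite components_pgraph => /imsetP[x xs ->].
  rewrite -prod_sign_porbit //; apply: eq_bigl => y; rewrite eq_porbit_mem.
  by case: (boolP (y \in porbit t x)) => [/mem_psupp_porbit->|]; rewrite ?andbF // xs.
rewrite -(big_morph _ (exprD (-1)) (expr0 _)); congr (_ ^+ _).
rewrite /c_neg -sum1_card big_mkcond [RHS]big_mkcond; apply: eq_bigr => C _.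
by rewrite !inE -andbA -/(neg C); case: (_ \in _) => //=; case: (neg C).
Qed.

(** Permutations are grouped by their graph: the fibre over [U] has [2 ^ c_all U] elements, all with
    the same sign product. *)
Lemma sum_perm_sachs i :
  \sum_(s | (#|psupp s| == i) && ((pgraph s).2 \subset sg_edges G))
     \prod_(x in psupp s) sg_sign G [set x; s x] =
  \sum_(U | is_sachs G U && (#|U.1| == i)) (-1) ^+ c_neg G U * 2 ^+ c_all U.
Proof.
rewrite (partition_big (@pgraph T) (fun U => is_sachs G U && (#|U.1| == i))) /=; last first.
  by move=> s /andP[si sG]; rewrite is_sachs_pgraph sG.
apply: eq_bigr => U /andP[sU Ui]; have [t tU] := sachs_is_pgraph sU.
rewrite (eq_bigl (mem [set s | pgraph s == pgraph t])); last first.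
  move=> s; rewrite !inE tU; case: (pgraph s =P U) => [e|]; rewrite ?andbF ?andbT //.
  by rewrite -is_sachs_pgraph e sU andbT -(eqP Ui) -e eqxx.
rewrite (eq_bigr (fun _ => (-1) ^+ c_neg G U)); last first.
  move=> s; rewrite /= inE tU => /eqP e.
  have sG : (pgraph s).2 \subset sg_edges G by rewrite -is_sachs_pgraph e.
  by rewrite prod_sign_perm // e.
rewrite big_const iter_addr_0 card_pgraph_fiber -cycles_pgraph tU.
by rewrite -[LHS]mulr_natr natrX.
Qed.

Lemma E_sub_O i : E_ G i - O_ G i =
  (-1) ^+ i * \sum_(U | is_sachs G U && (#|U.1| == i)) (-1) ^+ c_neg G U * 2 ^+ c_all U.
Proof.
rewrite /E_ /O_ -mulrBr; congr (_ * _).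
rewrite [RHS](bigID (fun U => ~~ odd (c_neg G U))) /= -sumrN; congr (_ + _).
  apply: eq_big => U; first by rewrite andbA.
  by move=> /and3P[_ _ /negPf h]; rewrite -signr_odd h mul1r.
apply: eq_big => U; first by rewrite negbK andbA.
by move=> /and3P[_ _ h]; rewrite -signr_odd h mulN1r.
Qed.

End SachsExpansion.

(** * Coefficients of the permanental polynomial *)

Section ExtendPerm.

Variables (T T' : finType) (f : T -> T').
Hypothesis f_inj : injective f.
Implicit Types (p : {perm T}) (s : {perm T'}).

(** Serves to turn permutations of the index set of a submatrix into permutations of all indices. *)
Definition extend_fun p (x : T') : T' :=
  if [pick i | f i == x] is Some i then f (p i) else x.

Lemma extend_funE p i : extend_fun p (f i) = f (p i).
Proof.
by rewrite /extend_fun; case: pickP => [j /eqP/f_inj-> //|/(_ i)]; rewrite eqxx.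
Qed.

Lemma extend_fun_id p x : x \notin f @: T -> extend_fun p x = x.
Proof.
rewrite /extend_fun; case: pickP => [j /eqP<-|//].
by rewrite imset_f.
Qed.

Lemma extend_fun_inj p : injective (extend_fun p).
Proof.
move=> x y; case: (boolP (x \in f @: T)) => [/imsetP[i _ ->]|xf];
  case: (boolP (y \in f @: T)) => [/imsetP[j _ ->]|yf]; rewrite ?extend_funE.
- by move/f_inj/perm_inj->.
- by rewrite extend_fun_id // => e; move: yf; rewrite -e imset_f.
- by rewrite extend_fun_id // => e; move: xf; rewrite e imset_f.
- by rewrite !extend_fun_id.
Qed.

Definition extend_perm p : {perm T'} := perm (@extend_fun_inj p).

Lemma extend_permE p i : extend_perm p (f i) = f (p i).
Proof. by rewrite permE extend_funE. Qed.

Lemma extend_perm_inj : injective extend_perm.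
Proof.
move=> p q e; apply/permP=> i; apply: f_inj.
by rewrite -!extend_permE e.
Qed.

Lemma extend_perm_onto :
  extend_perm @: {perm T} = [set s | psupp s \subset f @: T].
Proof.
apply/setP=> s; rewrite inE; apply/imsetP/subsetP => [[p _ ->] x|sf].
  rewrite inE permE; apply: contraNT => /(extend_fun_id p)->; exact: eqxx.
have sfi i : s (f i) \in f @: T.
  case: (eqVneq (s (f i)) (f i)) => [->|h]; first exact: imset_f.
  by apply: sf; rewrite inE (inj_eq perm_inj).
have /fin_all_exists[p pE] : forall i, exists j, f j = s (f i).
  by move=> i; have /imsetP[j _ ->] := sfi i; exists j.
have p_inj : injective p.
  by move=> i j e; apply/f_inj/(@perm_inj _ s); rewrite -!pE e.
exists (perm p_inj) => //; apply/permP=> x.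
case: (boolP (x \in f @: T)) => [/imsetP[i _ ->]|xf].
  by rewrite extend_permE permE pE.
rewrite permE extend_fun_id //; apply/eqP; apply: contraNT xf => h.
by apply: sf; rewrite inE.
Qed.

End ExtendPerm.

(** * Principal permanents and coefficients as sums over supports *)

Section PermanentCoefficients.

Variables (R : comNzRingType) (n : nat) (A : 'M[R]_n).

Lemma leq_per_rank k (f g : {ffun 'I_k -> 'I_n}) : (k <= n)%N ->
  increasing f -> increasing g -> per (mxsub f g A) != 0 -> (k <= per_rank A)%N.
Proof.
rewrite -ltnS => kn fi gi nz; apply: (leq_bigmax_cond (Ordinal kn)).
by apply/existsP; exists f; apply/existsP; exists g; apply/and3P.
Qed.

Lemma per_rank_leq : (per_rank A <= n)%N.
Proof. by apply/bigmax_leqP => k _; rewrite -ltnS. Qed.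

(** Lets principal submatrices count towards [per_rank]: [enum S] filters the sorted list of all
    ordinals, hence is sorted. *)
Lemma increasing_enum_val (S : {set 'I_n}) :
  increasing [ffun i : 'I_#|S| => enum_val i].
Proof.
apply/forallP=> i; apply/forallP=> j; apply/implyP=> ij; rewrite !ffunE.
have tr : transitive (relpre val ltn : rel 'I_n) by move=> x y z; apply: ltn_trans.
have srt : sorted (relpre val ltn) (enum S).
  rewrite {1}/enum_mem -enumT; apply: sorted_filter => //.
  by rewrite -sorted_map val_enum_ord iota_ltn_sorted.
have x0 : 'I_n := enum_val i.
rewrite !(enum_val_nth x0).
by apply: (sorted_ltn_nth tr) => //; rewrite inE -cardE.
Qed.

Lemma card_psupp_leq (s : 'S_n) : (#|psupp s| <= n)%N.
Proof. by apply: leq_trans (max_card _) _; rewrite card_ord. Qed.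

Hypothesis A_diag : forall i, A i i = 0.

(** Permutations of the index set of [S] extend to those supported in [S]; any that fixes a point of
    [S] picks up a zero diagonal entry, which leaves support exactly [S]. *)
Lemma principal_per (S : {set 'I_n}) (f := [ffun i : 'I_#|S| => enum_val i]) :
  per (mxsub f f A) = \sum_(s | psupp s == S) \prod_(x in S) A x (s x).
Proof.
have f_inj : injective f by move=> i j; rewrite !ffunE => /enum_val_inj.
have fS : f @: 'I_#|S| = S.
  apply/setP=> x; apply/imsetP/idP => [[i _ ->]|xS]; first by rewrite ffunE enum_valP.
  by exists (enum_rank_in xS x); rewrite // ffunE enum_rankK_in.
transitivity (\sum_(s | psupp s \subset S) \prod_(x in S) A x (s x)); last first.
  rewrite (bigID (fun s => psupp s == S)) /= [X in _ + X]big1 ?addr0; last first.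
    move=> s /andP[sS nS]; have : psupp s \proper S by rewrite properEneq nS.
    case/properP=> _ [x xS]; rewrite inE negbK => /eqP e.
    by rewrite (bigD1 x) //= e A_diag mul0r.
  by apply: eq_bigl => s; case: eqP => [->|]; rewrite ?subxx ?andbF.
rewrite (eq_bigl (mem (extend_perm f_inj @: {perm 'I_#|S|}))); last first.
  by move=> s /=; rewrite extend_perm_onto inE fS.
rewrite big_imset /=; last by move=> p q _ _; apply: extend_perm_inj.
apply: eq_big => p; first by rewrite inE.
move=> _; transitivity (\prod_(x in f @: 'I_#|S|) A x (extend_perm f_inj p x)); last first.
  by apply: eq_bigl => x; rewrite fS.
rewrite big_imset /=; last by move=> i j _ _; apply: f_inj.
by apply: eq_big => i; rewrite ?inE // => _; rewrite mxE extend_permE.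
Qed.

Lemma sum_psupp_gt_rank i : (per_rank A < i <= n)%N ->
  \sum_(s : 'S_n | #|psupp s| == i) \prod_(x in psupp s) A x (s x) = 0.
Proof.
case/andP=> ri ilen.
rewrite (partition_big (@psupp 'I_n) (fun S => #|S| == i)) //=.
apply: big1 => S /eqP Si.
rewrite (eq_bigr (fun s : 'S_n => \prod_(x in S) A x (s x))); last by move=> s /andP[_ /eqP->].
rewrite (eq_bigl (fun s => psupp s == S)); last first.
  by move=> s; case: (psupp s =P S) => [->|]; rewrite ?andbF // Si eqxx.
rewrite -principal_per; apply/eqP; apply: contraLR ri => nz.
rewrite -leqNgt -Si; apply: leq_per_rank nz; rewrite ?Si //; exact: increasing_enum_val.
Qed.

Lemma per_polyE : per_poly A = \sum_(s : 'S_n)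
  ((-1) ^+ (n - #|psupp s|) * \prod_(x in psupp s) A x (s x)) *: 'X^(n - #|psupp s|).
Proof.
apply: eq_bigr => s _; rewrite (bigID (mem (psupp s))) /=.
rewrite (eq_bigr (fun x => (A x (s x))%:P)); last first.
  by move=> x; rewrite inE => nx; rewrite !mxE (eq_sym x) (negPf nx) subr0.
rewrite [X in _ * X](eq_bigr (fun=> - 'X)); last first.
  by move=> x; rewrite inE negbK => /eqP e; rewrite !mxE e eqxx A_diag sub0r.
rewrite prodr_const (_ : #|_| = n - #|psupp s|)%N; last first.
  have e : (#|psupp s| + #|[predC psupp s]| = n)%N by rewrite cardC card_ord.
  by apply: (@addnI #|psupp s|); rewrite subnKC ?card_psupp_leq //.
rewrite -rmorph_prod [(- 'X) ^+ _]exprNn /= -mul_polyC polyCM polyC_exp polyCN polyC1.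
by rewrite mulrA [X in X * _]mulrC.
Qed.

Lemma coef_per_poly i : (i <= n)%N -> (per_poly A)`_(n - i) =
  (-1) ^+ (n - i) * \sum_(s : 'S_n | #|psupp s| == i) \prod_(x in psupp s) A x (s x).
Proof.
move=> ilen; rewrite per_polyE coef_sumMXn mulr_sumr; apply: eq_big => s /=.
  by rewrite eqn_sub2lE ?card_psupp_leq.
by move=> /eqP e; rewrite e.
Qed.

End PermanentCoefficients.

(** * Multiplicity of the root 0 and the final equivalence *)

Lemma mup0_geqP (F : fieldType) (p : {poly F}) m : p != 0 ->
  reflect (forall j, (j < m)%N -> p`_j = 0) (m <= mup 0 p)%N.
Proof.
move=> nz; rewrite mup_geq // subr0; apply: (iffP idP) => [/dvdpP[q ->] j jm|h].
  by rewrite coefMXn jm.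
(* The first [m] coefficients form [take_poly m p]; once it vanishes, the rest is a multiple of
   ['X^m]. *)
rewrite -(poly_take_drop m p) (_ : take_poly m p = 0) ?add0r ?dvdp_mull //.
by apply/polyP=> j; rewrite coef_take_poly coef0; case: ifP => // /h.
Qed.

(** The coefficient of ['X^n] comes from the identity alone, the only permutation of empty support,
    and is a sign. *)
Lemma per_poly_neq0 (R : comNzRingType) n (A : 'M[R]_n) :
  (forall i, A i i = 0) -> per_poly A != 0.
Proof.
move=> A_diag; apply/eqP=> e; have := coef_per_poly A_diag (leq0n n).
rewrite e coef0 (big_pred1 1%g) => [|s].
  rewrite big1 ?mulr1 => [/esym/eqP|x]; first by rewrite signr_eq0.
  by rewrite inE perm1 eqxx.
rewrite cards_eq0; apply/eqP/eqP => [s0|->].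
  apply/permP=> x; rewrite perm1; apply/eqP; apply: contraFT (in_set0 x) => h.
  by rewrite -s0 inE.
by apply/setP=> x; rewrite !inE perm1 eqxx.
Qed.

Lemma per_rank_nullityP (F : fieldType) n (A : 'M[F]_n) :
  (forall i, A i i = 0) ->
  (per_rank A + per_nullity A)%N = n <->
  \sum_(s : 'S_n | #|psupp s| == per_rank A) \prod_(x in psupp s) A x (s x) != 0.
Proof.
move=> A_diag; set k := per_rank A; have kn : (k <= n)%N := per_rank_leq A.
have pnz := per_poly_neq0 A_diag.
(* The coefficient of index [j] collects the supports of size [n - j], here larger than [k]. *)
have low j : (j < n - k)%N -> (per_poly A)`_j = 0.
  move=> jnk; have jn : (j <= n)%N by rewrite ltnW // (leq_trans jnk) ?leq_subr.
  rewrite -(subKn jn) coef_per_poly ?leq_subr // sum_psupp_gt_rank ?mulr0 //.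
  by rewrite leq_subr andbT ltn_subRL addnC -ltn_subRL.
have ge : (n - k <= per_nullity A)%N by apply/(mup0_geqP _ pnz).
(* Given [ge], the equality fails exactly when the multiplicity exceeds [n - k], which the
   coefficient of index [n - k] decides. *)
apply: (@iff_trans _ (~~ (n - k < per_nullity A)%N)).
  rewrite -leqNgt; split=> [e|le]; first by rewrite -{2}e addKn.
  by rewrite (_ : per_nullity A = n - k)%N ?subnKC //; apply/eqP; rewrite eqn_leq le.
have top := coef_per_poly A_diag kn.
split; last first.
  apply: contraNN => /(mup0_geqP _ pnz)/(_ _ (leqnn _))/eqP.
  by rewrite top mulf_eq0 signr_eq0.
apply: contraNN => /eqP s0; apply/(mup0_geqP _ pnz) => j.
rewrite ltnS leq_eqVlt => /orP[/eqP->|/low //].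
by rewrite top s0 mulr0.
Qed.

(** Permutations using a non-edge have a zero factor; what remains is a product of integer signs, so
    the sum can be evaluated in [int]. *)
Lemma sum_psupp_signed_adj (R : comNzRingType) n (G : signed_graph 'I_n) i :
  \sum_(s : 'S_n | #|psupp s| == i) \prod_(x in psupp s) signed_adj R G x (s x) =
  (\sum_(s : 'S_n | (#|psupp s| == i) && ((pgraph s).2 \subset sg_edges G))
     \prod_(x in psupp s) sg_sign G [set x; s x])%:~R.
Proof.
rewrite (bigID (fun s : 'S_n => (pgraph s).2 \subset sg_edges G)) /=.
rewrite [X in _ + X]big1 ?addr0 => [|s /andP[_ /subsetPn[_ /imsetP[x xs ->] nG]]].
  rewrite rmorph_sum; apply: eq_bigr => s /andP[_ /subsetP sG].
  rewrite rmorph_prod; apply: eq_bigr => x xs.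
  by rewrite mxE sG //; apply: imset_f.
by rewrite (bigD1 x) //= mxE (negPf nG) mul0r.
Qed.

Theorem theorem2 (F : numFieldType) (n : nat) (A : 'M[F]_n)
  (G : signed_graph 'I_n)
  (A_entries : forall i j, A i j \in [:: 0; 1; -1])
  (A_sym : A^T = A)
  (A_diag : forall i, A i i = 0)
  (A_adj : signed_adj F G = A) (k : nat) (k_rank : k = per_rank A) :
  (per_rank A + per_nullity A)%N = n <-> E_ G k <> O_ G k.
Proof.
apply: iff_trans (per_rank_nullityP A_diag) _.
(* In characteristic zero an integer vanishes in [F] only if it is zero, so the comparison moves to
   [int]; the sign [(-1) ^+ k] then cancels. *)
rewrite -k_rank -A_adj sum_psupp_signed_adj intr_eq0 sum_perm_sachs.
rewrite -(mulrI_eq0 _ (lreg_sign (n := k))) -E_sub_O subr_eq0.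
by split=> /eqP.
Qed.
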